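(* Let $(L,\cdot)$ be a quasigroup (respectively, loop) with holomorph $H(L)$. If $H(L)$ is an AIPQ (respectively, AIPL) or a CIPQ (respectively, CIPL), then $H(L)\cong L$.
   Context: Mappings are written on the right of their arguments, so $x\alpha$ is the image of $x$ under $\alpha$, and $\alpha\beta$ means first $\alpha$, then $\beta$. A quasigroup $(L,\cdot)$ is a non-empty set with a binary operation such that for all $a,b\in L$ the equations $a\cdot x=b$ and $y\cdot a=b$ have unique solutions $x,y\in L$. A loop is a quasigroup with a (unique) two-sided identity element $e$. For $x\in L$, the right inverse $x^\rho=xJ_\rho$ and the left inverse $x^\lambda=xJ_\lambda$ are the elements with $x\cdot x^\rho=e^\rho$ and $x^\lambda\cdot x=e^\lambda$, where $e^\rho$ and $e^\lambda$ are the right and left identity elements; whenever inverses are used in a quasigroup these elements are assumed to exist (in a loop both equal $e$). $AUM(L)$ is the automorphism group: the group of bijections $A$ of $L$ with $xA\cdot yA=(x\cdot y)A$ for all $x,y\in L$. The holomorph $H(L)$ is the set of pairs $(\alpha,x)$ with $\alpha\in AUM(L)$, $x\in L$, with operation $(\alpha,x)\circ(\beta,y)=(\alpha\beta,\ x\beta\cdot y)$. A quasigroup (loop) is an AIPQ (AIPL), i.e. an automorphic inverse property quasigroup (loop), if it satisfies $(xy)^\rho=x^\rho y^\rho$ for all $x,y$, or equivalently $(xy)^\lambda=x^\lambda y^\lambda$ for all $x,y$. A quasigroup (loop) is a CIPQ (CIPL), i.e. a cross inverse property quasigroup (loop), if it satisfies one of the equivalent identities $(xy)x^\rho=y$, $x(yx^\rho)=y$,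 $x^\lambda(yx)=y$, $(x^\lambda y)x=y$. *)

(* Defs.v *)
From HB Require Import structures.
From mathcomp Require Import all_boot.

Set Implicit Arguments.
Unset Strict Implicit.
Unset Printing Implicit Defensive.

Import Algebra.

Local Open Scope group_scope.

Definition quasigroup (L : magmaType) : Prop :=
  [/\ inhabited L,
      forall a b : L, exists! x : L, a * x = b &
      forall a b : L, exists! y : L, y * a = b].

Definition loop (L : magmaType) : Prop :=
  quasigroup L /\ exists e : L, left_id e *%g /\ right_id e *%g.

Definition isomorphic (G H : magmaType) : Prop :=
  exists f : {multiplicative G -> H}, bijective f.

(* [J] is the map x |-> x^rho relative to the right identity [e = e^rho].
   In a quasigroup both [e] and [J] are unique when they exist. *)
Definition rho_inverse (L : magmaType) (e : L) (J : L -> L) : Prop :=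
  right_id e *%g /\ right_inverse e J *%g.

(* Likewise x |-> x^lambda, relative to the left identity [e = e^lambda]. *)
Definition lambda_inverse (L : magmaType) (e : L) (J : L -> L) : Prop :=
  left_id e *%g /\ left_inverse e J *%g.

(* A quasigroup with both a right and a left identity is already a loop, so each
   form of an inverse property only requires the one-sided identity and inverses
   that it mentions, and a property holds when one of its equivalent forms does. *)

Definition AIP (L : magmaType) : Prop :=
  (exists (e : L) (J : L -> L),
      rho_inverse e J /\ forall x y, J (x * y) = J x * J y)
  \/
  (exists (e : L) (J : L -> L),
      lambda_inverse e J /\ forall x y, J (x * y) = J x * J y).

Definition CIP (L : magmaType) : Prop :=
  (exists (e : L) (J : L -> L),
      rho_inverse e J /\
      ((forall x y, (x * y) * J x = y) \/ (forall x y, x * (y * J x) = y)))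
  \/
  (exists (e : L) (J : L -> L),
      lambda_inverse e J /\
      ((forall x y, J x * (y * x) = y) \/ (forall x y, (J x * y) * x = y))).

Definition AIPQ (L : magmaType) : Prop := quasigroup L /\ AIP L.
Definition CIPQ (L : magmaType) : Prop := quasigroup L /\ CIP L.
Definition AIPL (L : magmaType) : Prop := loop L /\ AIP L.
Definition CIPL (L : magmaType) : Prop := loop L /\ CIP L.

Record AUM (L : magmaType) := Aum {
  aum_val :> {multiplicative L -> L};
  aum_bij : bijective aum_val
}.

(* Mappings act on the right, so the product of [a] and [b] applies [a] first. *)
Definition aum_mul (L : magmaType) (a b : AUM L) : AUM L :=
  @Aum L (b \o a) (bij_comp (aum_bij b) (aum_bij a)).

Definition holomorph (L : magmaType) : Type := (AUM L * L)%type.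

Definition holomorph_mul (L : magmaType) (u v : holomorph L) : holomorph L :=
  (aum_mul u.1 v.1, v.1 u.2 * v.2).

HB.instance Definition _ (L : magmaType) :=
  hasMul.Build (holomorph L) (@holomorph_mul L).

(* Main.v *)
From HB Require Import structures.
From Stdlib Require Import FunctionalExtensionality ProofIrrelevance.
Require Import Defs.
From mathcomp Require Import all_boot.

(** Write [1] for the identity automorphism.  Each hypothesis on [H = H(L)]
    forces every automorphism of [L] to be trivial; then [(1, x) |-> x] is the
    required isomorphism.

    An inverse property supplies a left or right identity of [H].  It has the form
    [(1, e)], where [e] is an identity of [L] on the same side and is fixed by all
    automorphisms.  Hence the elements [(a, e)] form a copy of [AUM(L)] inside [H],
    and cancellation in [H] makes [(a^-1, e)] the inverse of [(a, e)].  The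
    elements [(1, y)] form a copy of [L] in [H], on which conjugation by
    [(a, e)] acts as [a] or [a^-1], up to a translation by [e].

    A cross inverse identity at [(a, e)] and [(1, y)] says that this conjugation
    fixes [(1, y)]; the instance [a = 1] removes the translation by [e], so
    [a y = y] ([CIP_aum_trivial]).  The automorphic inverse identity at the same
    two elements says that [a^-1] fixes the inverse of [y]; since every element of a
    quasigroup is an inverse, [a] is again trivial ([AIP_aum_trivial]). *)

Set Implicit Arguments.
Unset Strict Implicit.
Unset Printing Implicit Defensive.

Import Algebra.

Local Open Scope group_scope.

Section Quasigroup.

Variable L : magmaType.
Hypothesis qL : quasigroup L.

Lemma quasigroup_mulI (a x y : L) : a * x = a * y -> x = y.
Proof.
case: qL => _ /(_ a (a * y))[z [_ z_uniq]] _ eq_xy.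
by rewrite -(z_uniq x eq_xy) (z_uniq y).
Qed.

Lemma quasigroup_Imul (a x y : L) : x * a = y * a -> x = y.
Proof.
case: qL => _ _ /(_ a (y * a))[z [_ z_uniq]] eq_xy.
by rewrite -(z_uniq x eq_xy) (z_uniq y).
Qed.

Lemma quasigroup_divl (a b : L) : exists x, a * x = b.
Proof. by case: qL => _ /(_ a b)[x [? _]] _; exists x. Qed.

Lemma quasigroup_divr (a b : L) : exists x, x * a = b.
Proof. by case: qL => _ _ /(_ a b)[x [? _]]; exists x. Qed.

End Quasigroup.

Section Automorphisms.

Variable L : magmaType.
Implicit Types (a b : AUM L) (x y : L).

Definition aum_id : AUM L := @Aum L idfun (Bijective (frefl _) (frefl _)).

Lemma aumM a x y : a (x * y) = a x * a y.
Proof. exact: gmulfM. Qed.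

(** The proofs packed with the underlying function carry no information, so an
    automorphism is determined by its values. *)
Lemma aum_ext a b : a =1 b -> a = b.
Proof.
case: a b => [[f [[fM]]] f_bij] [[g [[gM]]] g_bij] /= eq_fg.
have {}eq_fg : f = g by exact: functional_extensionality.
by subst g; rewrite (proof_irrelevance _ gM fM) (proof_irrelevance _ g_bij f_bij).
Qed.

Lemma aum_inverse a : exists b, cancel a b /\ cancel b a.
Proof.
case: (aum_bij a) => g aK gK.
have gM : {morph g : x y / x * y >-> x * y}.
  by move=> x y; apply: (can_inj aK); rewrite aumM !gK.
pose gm := isMultiplicative.Build L L g gM.
pose gf : {multiplicative L -> L} := HB.pack g gm.
by exists (@Aum L gf (Bijective gK aK)).
Qed.

Lemma holomorph_mulE a b x y :
  ((a, x) : holomorph L) * ((b, y) : holomorph L) = (aum_mul a b, b x * y).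
Proof. by []. Qed.

Lemma aum_mulV a b : cancel a b -> aum_mul a b = aum_id.
Proof. by move=> aK; apply: aum_ext. Qed.

Lemma aum_mul1 a : aum_mul aum_id a = a.
Proof. exact: aum_ext. Qed.

Lemma aum_mulr1 a : aum_mul a aum_id = a.
Proof. exact: aum_ext. Qed.

Lemma holomorph_iso :
  (forall a, a =1 id) -> isomorphic (holomorph L) L.
Proof.
move=> aum_trivial.
have sndM : {morph (fun u : holomorph L => u.2) : u v / u * v >-> u * v}.
  by move=> [a x] [b y]; rewrite holomorph_mulE /= aum_trivial.
pose sm := isMultiplicative.Build (holomorph L) L (fun u => u.2) sndM.
pose s : {multiplicative holomorph L -> L} :=
  HB.pack (fun u : holomorph L => u.2) sm.
exists s; exists (fun x => (aum_id, x)) => // -[a x] /=.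
by congr (_, _); apply: aum_ext => y; rewrite !aum_trivial.
Qed.

Hypothesis qL : quasigroup L.

(** A right identity of a quasigroup is unique, hence fixed by automorphisms. *)
Lemma holomorph_right_id (E : holomorph L) :
  right_id E *%g ->
  exists e, [/\ E = (aum_id, e), right_id e *%g & forall a, a e = e].
Proof.
case: E => c e idE.
have c1 : c = aum_id.
  by have := idE (aum_id, e); rewrite holomorph_mulE aum_mul1 => -[].
subst c.
have xe : right_id e *%g by move=> x; have [] := idE (aum_id, x).
exists e; split=> // a; have [b [aK bK]] := aum_inverse a.
by apply: (quasigroup_mulI qL (a := e)); rewrite xe -{1}(bK e) -aumM xe bK.
Qed.

Lemma holomorph_left_id (E : holomorph L) :
  left_id E *%g ->
  exists e, [/\ E = (aum_id, e), left_id e *%g & forall a, a e = e].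
Proof.
case: E => c e idE.
have c1 : c = aum_id.
  by have := idE (aum_id, e); rewrite holomorph_mulE aum_mulr1 => -[].
subst c.
have ex : left_id e *%g by move=> x; have [] := idE (aum_id, x).
exists e; split=> // a; apply: (quasigroup_Imul qL (a := e)).
by case: (idE (a, e)) => _ ->; rewrite ex.
Qed.

Hypothesis qH : quasigroup (holomorph L).

Lemma rho_inverse_unique (E : holomorph L) J u v :
  rho_inverse E J -> u * v = E -> J u = v.
Proof. by case=> _ JP uv; apply: (quasigroup_mulI qH (a := u)); rewrite JP. Qed.

Lemma lambda_inverse_unique (E : holomorph L) J u v :
  lambda_inverse E J -> v * u = E -> J u = v.
Proof. by case=> _ JP vu; apply: (quasigroup_Imul qH (a := u)); rewrite JP. Qed.

(** Each identity, read at [(a, e)] and [(1, y)], says that [y] is the image of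
    [b y] or [a y] under a map that does not depend on [a]: a translation by [e].
    At [a = 1] the same identity shows that this map is the identity. *)
Lemma CIP_aum_trivial : CIP (holomorph L) -> forall a, a =1 id.
Proof.
move=> cip a; have [b [aK bK]] := aum_inverse a.
case: cip => [] [E [J [JP cip]]].
- have [e [defE xe fix_e]] := holomorph_right_id (proj1 JP).
  have Je (c d : AUM L) : cancel c d -> J (c, e) = (d, e).
    move=> cK; apply: (rho_inverse_unique JP).
    by rewrite holomorph_mulE aum_mulV // fix_e xe defE.
  suff b1 y : b y = y by move=> y; rewrite -[in LHS](b1 y) bK.
  case: cip => cip.
  + have cipE (c d : AUM L) : cancel c d -> d (e * y) = y.
      move=> cK; have := cip (c, e) (aum_id, y).
      by rewrite (Je _ _ cK) !holomorph_mulE /= xe => -[].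
    have ey : e * y = y by exact: (cipE aum_id aum_id).
    by have := cipE _ _ aK; rewrite ey.
  + have cipE (c d : AUM L) : cancel c d -> e * d y = y.
      move=> cK; have := cip (c, e) (aum_id, y).
      by rewrite (Je _ _ cK) !holomorph_mulE /= fix_e xe => -[].
    by apply: (quasigroup_mulI qL (a := e));
       rewrite (cipE _ _ aK); apply/esym/(cipE aum_id aum_id).
- have [e [defE ex fix_e]] := holomorph_left_id (proj1 JP).
  have Je (c d : AUM L) : cancel d c -> J (c, e) = (d, e).
    move=> dK; apply: (lambda_inverse_unique JP).
    by rewrite holomorph_mulE aum_mulV // fix_e ex defE.
  move=> y; apply: (quasigroup_Imul qL (a := e)).
  have cipE (c d : AUM L) : cancel d c -> c y * e = y.
    move=> dK; case: cip => /(_ (c, e) (aum_id, y));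
      by rewrite (Je _ _ dK) !holomorph_mulE /= ?fix_e ex => -[].
  by rewrite (cipE _ _ bK); apply/esym/(cipE aum_id aum_id).
Qed.

(** In the right-handed case [(1, x)(a, e) = (a, a x)] has inverse [(b, z)] with
    [b] inverse to [a] and [x z = e], whereas the product of the inverses of the
    two factors is [(b, b z)]; so [b] fixes [z], which is arbitrary as [x] varies.
    The left-handed case uses [(a, e)(1, x) = (a, x)] in the same way. *)
Lemma AIP_aum_trivial : AIP (holomorph L) -> forall a, a =1 id.
Proof.
move=> aip a; have [b [aK bK]] := aum_inverse a.
suff b1 z : b z = z by move=> z; rewrite -[in LHS](b1 z) bK.
case: aip => [] [E [J [JP aip]]].
- have [e [defE xe fix_e]] := holomorph_right_id (proj1 JP).
  have JE (c d : AUM L) x t : cancel c d -> d x * t = e -> J (c, x) = (d, t).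
    move=> cK xt; apply: (rho_inverse_unique JP).
    by rewrite holomorph_mulE aum_mulV // xt defE.
  have [x xz] := quasigroup_divr qL z e.
  have := aip (aum_id, x) (a, e); rewrite holomorph_mulE aum_mul1 xe.
  rewrite (JE a b (a x) z) ?aK // (JE aum_id aum_id x z) //.
  by rewrite (JE a b e e) ?fix_e // holomorph_mulE xe => -[_ /esym].
- have [e [defE ex fix_e]] := holomorph_left_id (proj1 JP).
  have JE (c d : AUM L) x t : cancel d c -> c t * x = e -> J (c, x) = (d, t).
    move=> dK tx; apply: (lambda_inverse_unique JP).
    by rewrite holomorph_mulE aum_mulV // tx defE.
  have [x zx] := quasigroup_divl qL z e.
  have := aip (a, e) (aum_id, x); rewrite holomorph_mulE aum_mulr1 ex.
  rewrite (JE a b x (b z)) ?bK // (JE aum_id aum_id x z) //.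
  by rewrite (JE a b e e) ?fix_e // holomorph_mulE ex => -[].
Qed.

End Automorphisms.

Theorem corollary2p2 (L : magmaType) :
  (quasigroup L ->
   AIPQ (holomorph L) \/ CIPQ (holomorph L) ->
   isomorphic (holomorph L) L)
  /\
  (loop L ->
   AIPL (holomorph L) \/ CIPL (holomorph L) ->
   isomorphic (holomorph L) L).
Proof.
have quasi : quasigroup L -> AIPQ (holomorph L) \/ CIPQ (holomorph L) ->
    isomorphic (holomorph L) L.
  move=> qL [] [qH ip]; apply: holomorph_iso.
    exact: (AIP_aum_trivial qL qH ip).
  exact: (CIP_aum_trivial qL qH ip).
split=> // -[qL _] ip; apply: (quasi qL).
by case: ip => -[[qH _] ip]; [left | right].
Qed.
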